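(* Let $q$ be a prime power and $n>1$ an integer such that $\mathrm{char}(\mathbb{F}_{q^n})=2$, and let $L(x)$ be any $2$-nilpotent linearized polynomial over $\mathbb{F}_{q^n}$ such that $V_L\subsetneq Z_L$. Then, for any $a\in Z_L\setminus V_L$, the polynomial $f(x)=L(x)+x+a$ is an involution over $\mathbb{F}_{q^n}$ with no fixed points (in $\mathbb{F}_{q^n}$). In particular, if $L(x)$ is a $2$-nilpotent linearized polynomial over $\mathbb{F}_{q^n}$ with $\dim_{\mathbb{F}_q} V_L< n/2$, then there is some element $b\in Z_L\setminus V_L$.
   Context: A polynomial $L(x)\in \mathbb{F}_{q^n}[x]$ is linearized if it has the form $L(x)=\sum_{i=0}^{k}a_ix^{q^i}$ with $a_i\in\mathbb{F}_{q^n}$. $L(x)\in\mathbb{F}_{q^n}[x]$ is a $2$-nilpotent linearized polynomial ($2$-NLP) over $\mathbb{F}_{q^n}$ if $L(x)$ is linearized, $L(x)\not\equiv 0\pmod{x^{q^n}-x}$ and $L(L(x))\equiv 0\pmod{x^{q^n}-x}$. $Z_L=\{z\in\mathbb{F}_{q^n} : L(z)=0\}$ and $V_L=\{L(z) : z\in\mathbb{F}_{q^n}\}$; for linearized $L$ both are $\mathbb{F}_q$-vector spaces. A polynomial $f(x)\in\mathbb{F}_{q^n}[x]$ is an involution over $\mathbb{F}_{q^n}$ if $f(f(z))=z$ for all $z\in\mathbb{F}_{q^n}$. *)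

(* Defs.v *)
From mathcomp Require Import all_boot all_order all_algebra all_field.

Set Implicit Arguments.
Unset Strict Implicit.
Unset Printing Implicit Defensive.

Import GRing.Theory.
Local Open Scope ring_scope.

Definition linearized (q : nat) (R : nzRingType) (L : {poly R}) : Prop :=
  exists (k : nat) (a : 'I_k.+1 -> R), L = \sum_(i < k.+1) a i *: 'X^(q ^ i).

(* The degree of L is not bounded by q ^ n: both conditions are taken modulo
   'X^(q ^ n) - 'X. *)
Definition two_nilpotent_linearized (q n : nat) (F : fieldType)
    (L : {poly F}) : Prop :=
  [/\ linearized q L,
      ~~ ('X^(q ^ n) - 'X %| L) &
      'X^(q ^ n) - 'X %| L \Po L].

Definition zero_set (F : finFieldType) (L : {poly F}) : {set F} :=
  [set z | L.[z] == 0].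

Definition value_set (F : finFieldType) (L : {poly F}) : {set F} :=
  [set L.[z] | z : F].

(* finvect_type E is E itself, with the finite type structure inherited from
   its finite base field. *)
Definition value_space (Fq : finFieldType) (E : fieldExtType Fq)
    (L : {poly finvect_type E}) : {vspace finvect_type E} :=
  <<enum (value_set L)>>%VS.

Definition poly_involution (F : fieldType) (f : {poly F}) : Prop :=
  involutive (horner f).

Lemma linearized_horner_linear (Fq : finFieldType) (E : fieldExtType Fq)
    (L : {poly finvect_type E}) : linearized #|Fq| L -> linear (horner L).
Proof.
case=> k [a ->] c x y.
rewrite !horner_sum scaler_sumr -big_split /=; apply: eq_bigr => i _.
rewrite !hornerZ !hornerXn scalerAr -mulrDr; congr (_ * _).
have [p p_pr charFp] := finPcharP Fq.
have charEp : p \in [pchar (finvect_type E)] by rewrite pchar_lalg.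
have card_q : p.-nat #|Fq|.
  rewrite -cardsT. exact: (pprimeChar_pgroup charFp).
rewrite exprDn_pchar; last first.
  by rewrite (eq_pnat _ (pcharf_eq charEp)) pnatX card_q.
rewrite exprZn; congr (_ *: _ + _).
elim: (nat_of_ord i) => [|j IHj]; first by rewrite expn0 expr1.
by rewrite expnSr exprM IHj expf_card.
Qed.

(* For linearized L, spanning adds nothing to the value set, so the dimension
   of value_space L is that of the value set as a subspace. *)
Lemma mem_value_space (Fq : finFieldType) (E : fieldExtType Fq)
    (L : {poly finvect_type E}) : linearized #|Fq| L ->
  value_space L =i value_set L.
Proof.
move=> /linearized_horner_linear linL y.
have L0 : L.[0] = 0.
  by have := linL (-1) 0 0; rewrite scaler0 addr0 scaleN1r addNr.
apply/idP/idP => [|Vy]; last first.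
  by rewrite memv_span // mem_enum.
move/coord_span=> ->.
apply: (big_ind (fun v => v \in value_set L)) => [|u v|i _].
- by apply/imsetP; exists 0; rewrite ?L0.
- case/imsetP=> x _ -> /imsetP[z _ ->]; apply/imsetP; exists (1 *: x + z) => //.
  by rewrite linL scale1r.
have : (in_tuple (enum (value_set L)))`_i \in value_set L.
  rewrite -mem_enum -[enum _]/(val (in_tuple (enum (value_set L)))).
  by rewrite mem_nth ?size_tuple.
case/imsetP=> x _ ->; apply/imsetP; set c := coord _ _ _.
by exists (c *: x + 0) => //; rewrite linL L0 addr0.
Qed.

(* Main.v *)
Require Import Defs.
From HB Require Import structures.
From mathcomp Require Import all_boot all_order all_algebra all_field.

Import GRing.Theory.
Local Open Scope ring_scope.

(** As a map on the field, $L$ is $\mathbb{F}_q$-linear with $L\circ L=0$. Since $L(a)=0$,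
    $f(f(z))=2L(z)+z+2a=z$ in characteristic 2, while a fixed point would give $a=-L(z)=L(z)\in
    V_L$. If $Z_L\setminus V_L$ were empty, then $Z_L\subseteq V_L$, and rank-nullity would force
    $n\le 2\dim V_L$ ([dim_zero_set_sub_value_set]). *)

(** Every element of a field with $q^n$ elements is a root of $x^{q^n}-x$, so divisibility by this
    polynomial forces pointwise vanishing. *)
Lemma two_nilpotent_horner_horner {Fq : finFieldType} {E : fieldExtType Fq}
    {L : {poly finvect_type E}} (z : finvect_type E) :
  two_nilpotent_linearized #|Fq| (\dim {:E}) L -> L.[L.[z]] = 0.
Proof.
case=> _ _ /dvdpP[Q LL_eq].
have card_E : #|finvect_type E| = (#|Fq| ^ \dim {:E})%N.
  by rewrite -(card_vspacef (Vector.on (finvect_type E))) card_vspace.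
by rewrite -horner_comp LL_eq hornerM hornerD hornerXn hornerN hornerX -card_E
           expf_card subrr mulr0.
Qed.

Lemma dim_zero_set_sub_value_set {Fq : finFieldType} {E : fieldExtType Fq}
    {L : {poly finvect_type E}} :
  linearized #|Fq| L -> zero_set L \subset value_set L ->
  (\dim {:E} <= (\dim (value_space L)).*2)%N.
Proof.
move=> linL /subsetP sZV; pose LL : finvect_type E -> finvect_type E := horner L.
(* Evaluation is packaged as an endomorphism [f], whose image is [value_space L] and whose kernel
   has the elements of [zero_set L]. *)
pose LLin :=
  GRing.isLinear.Build _ _ _ _ LL (linearized_horner_linear linL).
pose Ll : {linear finvect_type E -> finvect_type E} := HB.pack LL LLin.
pose f : 'End(finvect_type E) := linfun Ll.
have fE x : f x = L.[x] by rewrite lfunE.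
have imf : limg f = value_space L.
  apply/vspaceP=> y; rewrite mem_value_space //.
  by apply/memv_imgP/imsetP=> -[x _ ->]; exists x; rewrite ?fE ?memvf.
have kf : (lker f <= value_space L)%VS.
  apply/subvP=> y; rewrite memv_ker fE mem_value_space // => Ly0.
  by apply: sZV; rewrite inE.
have /= dimE := limg_ker_dim f fullv.
rewrite capfv imf in dimE.
(* [finvect_type E] is [E] up to conversion, so the dimensions agree. *)
have -> : \dim {:E} = \dim {: finvect_type E} by [].
by rewrite -dimE -addnn leq_add2r dimvS.
Qed.

Theorem proposition2 (q n : nat) (Fq : finFieldType) (E : fieldExtType Fq)
    (card_Fq : #|Fq| = q) (dim_E : \dim {:E} = n) (n_gt1 : (1 < n)%N)
    (char2 : 2%N \in [pchar E]) :
  (forall L : {poly finvect_type E},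
     two_nilpotent_linearized q n L ->
     value_set L \proper zero_set L ->
     forall a : finvect_type E, a \in zero_set L :\: value_set L ->
       poly_involution (L + 'X + a%:P) /\
       (forall z : finvect_type E, (L + 'X + a%:P).[z] <> z)) /\
  (forall L : {poly finvect_type E},
     two_nilpotent_linearized q n L ->
     ((\dim (value_space L))%:R < n%:R / 2%:R :> rat) ->
     exists b : finvect_type E, b \in zero_set L :\: value_set L).
Proof.
subst q n; split=> [L nilL _ a|L nilL dimV].
  rewrite !inE => /andP[Va /eqP La].
  have addL x y : L.[x + y] = L.[x] + L.[y].
    case: nilL => /linearized_horner_linear linL _ _.
    by have := linL 1 x y; rewrite !scale1r.
  have char2' : 2%N \in [pchar (finvect_type E)] := char2.
  have fE z : (L + 'X + a%:P).[z] = L.[z] + z + a by rewrite !hornerE.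
  split=> z; rewrite !fE.
    (* What remains is $L(z)+L(z)+z+a+a$, where both pairs cancel. *)
    rewrite !addL (two_nilpotent_horner_horner _ nilL) La add0r addr0.
    by rewrite !addrA (addrr_pchar2 char2') add0r -addrA (addrr_pchar2 char2')
               addr0.
  (* The fixed point is itself a preimage of $a$ under $L$. *)
  move=> fz; case/imsetP: Va; exists z => //.
  apply/eqP; rewrite -(oppr_pchar2 char2' L.[z]) -addr_eq0.
  by rewrite addrC -(inj_eq (addIr z)) add0r addrAC fz.
case: (set_0Vmem (zero_set L :\: value_set L)) => [/eqP|[b ?]]; last by exists b.
rewrite setD_eq0; case: nilL => linL _ _ /(dim_zero_set_sub_value_set linL).
rewrite leqNgt => /negP[]; move: dimV.
(* Clearing the denominator turns the rational bound into $2\dim V_L<n$ over the naturals. *)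
by rewrite Num.Theory.ltr_pdivlMr // -natrM Num.Theory.ltr_nat muln2.
Qed.
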